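(* Fix a renewable capacity state $Q\ge 0$ and consider the single-period problem $$\max_{p,q}\ q\quad\text{s.t.}\quad D\!\left(\frac{p}{e(Q)}\right)\le f(Q),\qquad C(Q)+kq\le R(p,Q),\qquad q\ge 0,\ p\ge 0 .$$ If the optimal solution exhibits strictly positive expansion $q^*(Q)>0$, then the optimal price $p^*(Q)$ exists, is unique, and is given by $$p^*(Q)=\begin{cases}\dfrac{e(Q)}{\epsilon}, & \text{if } D\!\left(\dfrac1\epsilon\right)\le f(Q),\\[8pt] \dfrac{e(Q)}{\epsilon}\ln\!\left(\dfrac{M}{f(Q)}\right), & \text{if } D\!\left(\dfrac1\epsilon\right)> f(Q).\end{cases}$$
   Context: Constants: $M>0$ (market size), $\epsilon>0$ (demand sensitivity), $k>0$ (unit investment cost). Real-valued functions of the capacity $Q\ge 0$: emissions intensity $e(Q)>0$ with $e'(Q)<0$; delivered renewable electricity $f(Q)\ge 0$ with $f(0)=0$, $f'(Q)>0$, $f''(Q)<0$; marginal wholesale value $\pi(Q)$ with $\pi'(Q)<0$; costs $C_R(Q)\ge 0$ and $C_S(Q)\ge 0$. Demand is $D(x)=M\exp(-\epsilon x)$ (so $D(1/\epsilon)=M\exp(-1)$). Revenue is $R(p,Q)=p\,D(p/e(Q))$. The integrated non-investment cost is $C(Q)=C_S(Q)+C_R(Q)-f(Q)\pi(Q)$. The decision variables are the price $p$ and the capacity addition $q$. *)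

(* Defs.v *)
(* Stdlib real numbers. *)
From Stdlib Require Import Reals Lra.
Local Open Scope R_scope.

Definition nonneg_axis (x : R) : Prop := 0 <= x.

(* Functions of the capacity are total on R, but only their values on
   [0, +oo) are constrained; [D_in g g' nonneg_axis Q] says that g' Q is the
   derivative of g at Q relative to [0, +oo), hence the right derivative at
   Q = 0. No sign is imposed on [wholesale_value]. *)
Record model : Type := Model {
  market_size : R;
  sensitivity : R;
  unit_cost : R;
  intensity : R -> R;
  intensity' : R -> R;
  delivered : R -> R;
  delivered' : R -> R;
  delivered'' : R -> R;
  wholesale_value : R -> R;
  wholesale_value' : R -> R;
  cost_R : R -> R;
  cost_S : R -> R;
  market_size_pos : 0 < market_size;
  sensitivity_pos : 0 < sensitivity;
  unit_cost_pos : 0 < unit_cost;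
  intensity_pos : forall Q, 0 <= Q -> 0 < intensity Q;
  intensity_deriv : forall Q, 0 <= Q -> D_in intensity intensity' nonneg_axis Q;
  intensity'_neg : forall Q, 0 <= Q -> intensity' Q < 0;
  delivered_nonneg : forall Q, 0 <= Q -> 0 <= delivered Q;
  delivered_0 : delivered 0 = 0;
  delivered_deriv : forall Q, 0 <= Q -> D_in delivered delivered' nonneg_axis Q;
  delivered'_pos : forall Q, 0 <= Q -> 0 < delivered' Q;
  delivered'_deriv : forall Q, 0 <= Q -> D_in delivered' delivered'' nonneg_axis Q;
  delivered''_neg : forall Q, 0 <= Q -> delivered'' Q < 0;
  wholesale_value_deriv : forall Q, 0 <= Q -> D_in wholesale_value wholesale_value' nonneg_axis Q;
  wholesale_value'_neg : forall Q, 0 <= Q -> wholesale_value' Q < 0;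
  cost_R_nonneg : forall Q, 0 <= Q -> 0 <= cost_R Q;
  cost_S_nonneg : forall Q, 0 <= Q -> 0 <= cost_S Q
}.

Definition demand (m : model) (x : R) : R := market_size m * exp (- sensitivity m * x).

Definition revenue (m : model) (p Q : R) : R := p * demand m (p / intensity m Q).

Definition cost (m : model) (Q : R) : R := cost_S m Q + cost_R m Q - delivered m Q * wholesale_value m Q.

Definition feasible (m : model) (Q p q : R) : Prop :=
  demand m (p / intensity m Q) <= delivered m Q /\
  cost m Q + unit_cost m * q <= revenue m p Q /\
  0 <= q /\ 0 <= p.

Definition optimal (m : model) (Q p q : R) : Prop :=
  feasible m Q p q /\ forall p1 q1, feasible m Q p1 q1 -> q1 <= q.

Definition optimal_price (m : model) (Q p : R) : Prop :=
  exists q, optimal m Q p q.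

(* The optimal expansion q*(Q) is the value of the problem, a supremum, so
   that the existence of a price attaining it is not presupposed. By
   [optimal_is_optimal_expansion], the q-component of any optimal solution is
   this value. *)
Definition optimal_expansion (m : model) (Q qs : R) : Prop :=
  is_lub (fun q => exists p, feasible m Q p q) qs.

Lemma optimal_is_optimal_expansion (m : model) (Q p q : R) :
  optimal m Q p q -> optimal_expansion m Q q.
Proof.
intros [Hf Hm]; split.
- intros q1 [p1 H1]; exact (Hm p1 q1 H1).
- intros b Hb; apply Hb; exists p; exact Hf.
Qed.

(* Main.v *)
Require Import Defs.
From Stdlib Require Import Reals Lra Classical.
Local Open Scope R_scope.

(** A positive expansion forces f(Q) > 0, since demand never vanishes, and the
    budget constraint then binds: maximising q amounts to maximising revenue
    over the admissible prices. In the normalised price u = epsilon p / e(Q),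
    revenue is proportional to u exp(-u), which increases up to u = 1 and
    decreases afterwards, while the demand constraint reads u >= ln (M / f(Q)).
    Hence the unique maximiser is u = max (1, ln (M / f(Q))). *)

(* Multiplied by [exp u], this is [1 + (u - v) < exp (u - v)]: the hypothesis
   gives [u <= v * (1 + (u - v))]. *)
Lemma mul_exp_opp_lt (u v : R) :
  0 < v -> u <> v -> 0 <= (v - 1) * (u - v) -> u * exp (- u) < v * exp (- v).
Proof.
intros Hv Huv H.
replace (- v) with ((u - v) + - u) by ring.
rewrite exp_plus, <- Rmult_assoc.
apply Rmult_lt_compat_r; [apply exp_pos|].
assert (He : 1 + (u - v) < exp (u - v)) by (apply exp_ineq1; lra).
nra.
Qed.

Lemma demand_pos (m : model) (x : R) : 0 < demand m x.
Proof.
apply Rmult_lt_0_compat; [apply market_size_pos | apply exp_pos].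
Qed.

Lemma demand_le_iff (m : model) (x d : R) :
  0 < d -> demand m x <= d <-> ln (market_size m / d) <= sensitivity m * x.
Proof.
intros Hd; pose proof (market_size_pos m) as HM; unfold demand.
unfold Rdiv; rewrite ln_mult, ln_Rinv
  by (try apply Rinv_0_lt_compat; assumption).
replace (market_size m * exp (- sensitivity m * x))
  with (exp (ln (market_size m) - sensitivity m * x)).
2: { unfold Rminus; rewrite exp_plus, exp_ln by assumption.
     do 2 f_equal; ring. }
rewrite <- (exp_ln d Hd) at 1.
split; intros H.
- apply Rnot_lt_le; intros Hlt.
  apply (Rle_not_lt _ _ H), exp_increasing; lra.
- apply Rnot_lt_le; intros Hlt.
  apply exp_lt_inv in Hlt; lra.
Qed.

(** The sign hypothesis says that [v] lies between 1, the peak of [w * exp (- w)], and [u], so that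
    [u] is farther down the same slope. *)
Lemma revenue_lt (m : model) (Q u v : R) :
  0 <= Q -> 0 < v -> u <> v -> 0 <= (v - 1) * (u - v) ->
  revenue m (intensity m Q / sensitivity m * u) Q
    < revenue m (intensity m Q / sensitivity m * v) Q.
Proof.
intros HQ Hv Huv H.
pose proof (market_size_pos m) as HM; pose proof (sensitivity_pos m) as Hs.
pose proof (intensity_pos m Q HQ) as He.
assert (Hrev : forall w, revenue m (intensity m Q / sensitivity m * w) Q
  = intensity m Q / sensitivity m * market_size m * (w * exp (- w))).
{ intros w; unfold revenue, demand.
  replace (- sensitivity m * (intensity m Q / sensitivity m * w / intensity m Q))
    with (- w) by (field; lra).
  ring. }
rewrite !Hrev.
apply Rmult_lt_compat_l.
- apply Rmult_lt_0_compat; [apply Rdiv_lt_0_compat|]; assumption.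
- apply mul_exp_opp_lt; assumption.
Qed.

(** Without feasible points every real, in particular 0, is an upper bound of the empty set of
    expansions, so its least upper bound cannot be positive. *)
Lemma optimal_expansion_pos_feasible (m : model) (Q qs : R) :
  optimal_expansion m Q qs -> 0 < qs -> exists p q, feasible m Q p q.
Proof.
intros [_ Hlub] Hpos; apply NNPP; intros Hno.
assert (qs <= 0); [|lra].
apply Hlub; intros q [p H]; exfalso; apply Hno; exists p, q; exact H.
Qed.

Lemma unique_optimal_price (m : model) (Q p p0 q0 : R) :
  feasible m Q p0 q0 -> 0 <= p ->
  demand m (p / intensity m Q) <= delivered m Q ->
  (forall p1, 0 <= p1 -> demand m (p1 / intensity m Q) <= delivered m Q ->
     p1 <> p -> revenue m p1 Q < revenue m p Q) ->
  unique (optimal_price m Q) p.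
Proof.
intros (Hd0 & Hb0 & Hq0 & Hp0) Hp Hd Hmax.
pose proof (unit_cost_pos m) as Hk.
assert (Hle : forall p1, 0 <= p1 ->
  demand m (p1 / intensity m Q) <= delivered m Q -> revenue m p1 Q <= revenue m p Q).
{ intros p1 Hp1 Hd1; destruct (Req_dec p1 p) as [-> | Hne]; [lra|].
  left; apply Hmax; assumption. }
(* This expansion makes the budget constraint tight at [p]. *)
pose (q := (revenue m p Q - cost m Q) / unit_cost m).
assert (Hq : unit_cost m * q = revenue m p Q - cost m Q).
{ unfold q; field; lra. }
assert (Hf : feasible m Q p q).
(* The given feasible point yields [0 <= q]: revenue at [p] is at least that at [p0], which covers
   the cost. *)
{ pose proof (Hle p0 Hp0 Hd0).
  repeat split; [assumption | lra | nra | assumption]. }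
split.
- exists q; split; [exact Hf|].
  intros p1 q1 (Hd1 & Hb1 & _ & Hp1).
  pose proof (Hle p1 Hp1 Hd1); nra.
(* Another price earns strictly less, so its budget forces [q' < q], against its optimality. *)
- intros p' [q' [(Hd' & Hb' & _ & Hp') Hopt]].
  apply NNPP; intros Hne.
  pose proof (Hmax p' Hp' Hd' (not_eq_sym Hne)).
  pose proof (Hopt p q Hf); nra.
Qed.

Theorem theorem1 (m : model) (Q : R) (hQ : 0 <= Q)
    (qs : R) (hqs : optimal_expansion m Q qs) (hpos : 0 < qs) :
  unique (optimal_price m Q)
    (if Rle_dec (demand m (1 / sensitivity m)) (delivered m Q)
     then intensity m Q / sensitivity m
     else intensity m Q / sensitivity m * ln (market_size m / delivered m Q)).
Proof.
destruct (optimal_expansion_pos_feasible m Q qs hqs hpos) as (p0 & q0 & Hf0).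
assert (Hdel : 0 < delivered m Q).
{ destruct Hf0 as [H _].
  exact (Rlt_le_trans _ _ _ (demand_pos m _) H). }
pose proof (sensitivity_pos m) as Hs.
pose proof (intensity_pos m Q hQ) as He.
set (L := ln (market_size m / delivered m Q)).
assert (Hadm : forall u,
  demand m (intensity m Q / sensitivity m * u / intensity m Q) <= delivered m Q
    <-> L <= u).
{ intros u; rewrite demand_le_iff by assumption; fold L.
  replace (sensitivity m * (intensity m Q / sensitivity m * u / intensity m Q))
    with u by (field; lra).
  reflexivity. }
(* Both cases are treated at once: [v] will be 1 when [L <= 1], where the product vanishes, and [L]
   otherwise, where both factors are nonnegative. *)
assert (Hopt : forall v, 1 <= v -> L <= v ->
  (forall u, L <= u -> 0 <= (v - 1) * (u - v)) ->
  unique (optimal_price m Q) (intensity m Q / sensitivity m * v)).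
{ intros v Hv HLv Hsign.
  apply (unique_optimal_price m Q _ p0 q0 Hf0).
  - apply Rmult_le_pos; [left; apply Rdiv_lt_0_compat; assumption | lra].
  - apply Hadm; exact HLv.
  - intros p1 _.
    replace p1 with (intensity m Q / sensitivity m * (sensitivity m * p1 / intensity m Q))
      by (field; lra).
    set (u := sensitivity m * p1 / intensity m Q).
    intros Hd Hne; apply Hadm in Hd.
    apply revenue_lt; [assumption | lra | | apply Hsign; exact Hd].
    intros Huv; apply Hne; rewrite Huv; reflexivity. }
assert (HL1 : demand m (1 / sensitivity m) <= delivered m Q <-> L <= 1).
{ rewrite demand_le_iff by assumption; fold L.
  replace (sensitivity m * (1 / sensitivity m)) with 1 by (field; lra).
  reflexivity. }
destruct (Rle_dec _ _) as [Hle | Hgt]; rewrite HL1 in *.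
- rewrite <- (Rmult_1_r (intensity m Q / sensitivity m)).
  apply Hopt; [lra | exact Hle | intros; lra].
- apply Hopt; [lra | lra | intros u Hu; apply Rmult_le_pos; lra].
Qed.
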